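(* Let $m\ge 1$ and let $A\simeq\mathbb{Z}^m$ be a free abelian group with basis $a_1,\dots,a_m$. Then the set $SAT(A,1)$ of one-variable equations satisfiable in $A$ is negligible, i.e. $\lim_{r\to\infty}\rho_r(SAT(A,1))=0$. Moreover, as $r\to\infty$, $$\rho_r(SAT(A,1)) = \begin{cases} O\!\left(\frac{\ln r}{r}\right) & \text{if } m=1,\\ O\!\left(\frac1r\right) & \text{if } m\ge 2.\end{cases}$$
   Context: The space of equations in one variable $x$ over $A$ is the free abelian group $A_X$ with basis $x,a_1,\dots,a_m$ (written multiplicatively). Each $w\in A_X$ is uniquely $w=x^{\gamma}a_1^{\alpha_1}\cdots a_m^{\alpha_m}$ with $\gamma,\alpha_j\in\mathbb{Z}$. The norm is $\|w\|=\max\{|\gamma|,|\alpha_1|,\dots,|\alpha_m|\}$ and $B_r=\{w\in A_X:\|w\|\le r\}$. $SAT(A,1)\subseteq A_X$ is the set of $w$ such that the equation $w=1$ has a solution in $A$, i.e. there is $h\in A$ with $h^{\gamma}a_1^{\alpha_1}\cdots a_m^{\alpha_m}=1$. For $S\subseteq A_X$, $\rho_r(S)=|S\cap B_r|/|B_r|$. The implied constants in $O(\cdot)$ may depend on $m$. *)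

(* Defs.v *)
From HB Require Import structures.
From mathcomp Require Import all_boot all_order all_algebra finmap.
From mathcomp Require Import all_classical all_reals all_analysis.
From mathcomp Require Import zify.

Set Implicit Arguments.
Unset Strict Implicit.
Unset Printing Implicit Defensive.

Import Order.TTheory GRing.Theory Num.Theory.
Import numFieldNormedType.Exports.

Local Open Scope classical_set_scope.
Local Open Scope ring_scope.

(* Abelian groups are zmodTypes, hence written additively: the product
   a_1 ^ c_1 ... a_m ^ c_m of the multiplicative notation is
   \sum_j a j *~ c j, and the trivial element is 0. *)

Definition free_basis (m : nat) (A : zmodType) (a : 'I_m -> A) : Prop :=
  forall h : A, exists! c : {ffun 'I_m -> int}, h = \sum_(j < m) a j *~ c j.

(* The free abelian group on x, a_1, ..., a_m: the pair (gamma, alpha) is the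
   word x ^ gamma a_1 ^ alpha_1 ... a_m ^ alpha_m. *)
Definition equation (m : nat) : zmodType := (int * {ffun 'I_m -> int})%type.

Definition eval_equation (m : nat) (A : zmodType) (a : 'I_m -> A) (h : A)
    (w : equation m) : A :=
  h *~ w.1 + \sum_(j < m) a j *~ w.2 j.

Definition SAT (m : nat) (A : zmodType) (a : 'I_m -> A) : set (equation m) :=
  [set w | exists h : A, eval_equation a h w = 0].

Definition equation_norm (m : nat) (w : equation m) : nat :=
  maxn `|w.1|%N (\max_(j < m) `|w.2 j|%N).

Definition equation_ball (m r : nat) : set (equation m) :=
  [set w | (equation_norm w <= r)%N].

(* fset_set is a junk value on infinite sets; finite_equation_ball shows that this
   case does not arise in rho. *)
Lemma finite_equation_ball (m r : nat) : finite_set (@equation_ball m r).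
Proof.
have int_shift (z : int) : (`|z| <= r)%N ->
    exists k : 'I_(r.*2.+1), k%:Z - r%:Z = z.
  move=> zr; have lt_k : (`|(z + r%:Z)%R| < r.*2.+1)%N by lia.
  by exists (Ordinal lt_k) => /=; lia.
pose f (p : 'I_(r.*2.+1) * {ffun 'I_m -> 'I_(r.*2.+1)}) : equation m :=
  (p.1%:Z - r%:Z, [ffun j => (p.2 j)%:Z - r%:Z]).
apply: (@sub_finite_set _ _ (f @` setT)); last first.
  exact/finite_image/finite_finset.
move=> [g al]; rewrite /equation_ball /equation_norm /= geq_max => /andP[gr /bigmax_leqP ar].
have [k kE] := int_shift _ gr.
have [h hE] := choice (fun j => int_shift _ (ar j isT)).
exists (k, finfun h) => //; rewrite /f /= kE; congr pair.
by apply/ffunP => j; rewrite !ffunE hE.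
Qed.

Definition rho (R : realType) (m : nat) (S : set (equation m)) (r : nat) : R :=
  #|` fset_set (S `&` @equation_ball m r)|%:R / #|` fset_set (@equation_ball m r)|%:R.

(* Main.v *)
(* The word x ^ g a ^ al is satisfiable exactly when g divides every al_j (which
   forces al = 0 when g = 0). For k = |g| in [1, r] there are
   (2 floor(r/k) + 1)^m <= (3r/k)^m such al in the ball, so the count is at most
   1 + 2 (3r)^m sum_{k <= r} k^-m, to be compared with (2r+1)^(m+1). The sum is
   O(ln r) for m = 1 and bounded for m >= 2; for every m, it is o(r) since the
   Cesaro means of 1/k vanish. *)
Require Import Defs.
From mathcomp Require Import all_boot all_order all_algebra finmap.
From mathcomp Require Import all_classical all_reals all_analysis.
From mathcomp Require Import zify ring lra.

Set Implicit Arguments.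
Unset Strict Implicit.
Unset Printing Implicit Defensive.

Import Order.TTheory GRing.Theory Num.Theory.
Import numFieldNormedType.Exports.

Local Open Scope classical_set_scope.
Local Open Scope ring_scope.

(** If [h] has coordinates [c], the equation exhibits [c j * w.1 + w.2 j] as coordinates of 0; by
    uniqueness they vanish, and the quotients are [- c j]. *)
Lemma SAT_dvd (m : nat) (A : zmodType) (a : 'I_m -> A) (ha : free_basis a)
    (w : equation m) :
  SAT a w -> exists c : 'I_m -> int, forall j, w.2 j = w.1 * c j.
Proof.
move=> [h]; have [c [-> _]] := ha h; rewrite /eval_equation => hw.
have [d [_ d_uniq]] := ha 0.
exists (fun j => - c j) => j.
have dE : d = [ffun j => c j * w.1 + w.2 j].
  apply: d_uniq; rewrite -[LHS]hw mulrz_suml -big_split /=.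
  by apply: eq_bigr => i _; rewrite ffunE mulrzDr mulrzA.
have d0 : d = [ffun=> 0].
  by apply: d_uniq; rewrite big1 // => i _; rewrite ffunE.
have /ffunP/(_ j) := etrans (esym dE) d0.
by rewrite !ffunE => /addr0_eq <-; ring.
Qed.

Lemma finite_SAT_ball (m r : nat) (A : zmodType) (a : 'I_m -> A) :
  finite_set (SAT a `&` @equation_ball m r).
Proof. by apply: sub_finite_set (finite_equation_ball m r) => w []. Qed.

(** A word with nonzero [g] is encoded by the sign of [g] (hence the doubling), by [k.+1] = |g|, and
    by the quotients of the [al j] by [g]. The outer successor counts the trivial word. *)
Lemma card_SAT_ball_le (m r : nat) (A : zmodType) (a : 'I_m -> A)
    (ha : free_basis a) :
  (#|` fset_set (SAT a `&` @equation_ball m r)|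
     <= (\sum_(k < r) ((r %/ k.+1).*2.+1 ^ m).*2).+1)%N.
Proof.
pose T : finType := ((bool * 'I_r) * {ffun 'I_m -> 'I_(r.*2.+1)})%type.
pose q (p : bool * 'I_r) := (r %/ p.2.+1)%N.
(* The codomain in [T] must not depend on [k], so it has the largest size, and [D] cuts out the
   admissible values. *)
pose D p : pred 'I_(r.*2.+1) := fun i => (i < (q p).*2.+1)%N.
pose P : pred T := fun t => t.2 \in ffun_on (D t.1).
pose sg (p : bool * 'I_r) : int := (-1) ^+ p.1 * p.2.+1%:Z.
(* The offset r %/ k makes a quotient of absolute value at most r %/ k an ordinal
   below 2 (r %/ k) + 1. *)
pose f (t : T) : equation m :=
  (sg t.1, [ffun j => sg t.1 * ((t.2 j)%:Z - (q t.1)%:Z)]).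
have cardP : #|P| = (\sum_(k < r) ((r %/ k.+1).*2.+1 ^ m).*2)%N.
  rewrite -sum1_card -(pair_big_dep xpredT (fun p x => x \in ffun_on (D p))
    (fun _ _ => 1%N)) /=.
  rewrite -(pair_big xpredT xpredT (fun b k =>
    \sum_(x in ffun_on (D (b, k))) 1)%N) /= big_bool /= -big_split /=.
  apply: eq_bigr => k _; rewrite !sum1_card !card_ffun_on !card_ord.
  suff DE b : #|D (b, k)| = (r %/ k.+1).*2.+1 by rewrite !DE addnn.
  rewrite -sum1_card /D /q /= -(big_ord_widen _ (fun=> 1%N)) ?sum1_card ?card_ord //.
  by rewrite ltnS leq_double leq_div.
rewrite -cardP [#|P|]cardE -(size_map f).
apply: (@uniq_leq_size _ _ (0 :: _)); first exact: fset_uniq.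
move=> [g al]; rewrite in_fset_set; last exact: finite_SAT_ball.
rewrite inE => -[/(SAT_dvd ha)[c /= cE]].
rewrite /equation_ball /equation_norm /= geq_max => /andP[gr /bigmax_leqP ar].
rewrite inE; have [g0|g0] := eqVneq g 0.
  apply/orP; left; apply/eqP; rewrite g0; congr pair.
  by apply/ffunP => j; rewrite cE ffunE g0 mul0r.
apply/orP; right.
have kr : (`|g|.-1 < r)%N by lia.
pose p := (g < 0, Ordinal kr).
have sgE : sg p = g.
  by rewrite /sg /=; case: ltP => ?; rewrite ?expr1 ?expr0; lia.
have qE : q p = (r %/ `|g|)%N by rewrite /q /= prednK //; lia.
have c_le j : (`|c j| <= q p)%N.
  rewrite qE leq_divRL; last by lia.
  by rewrite mulnC -abszM -cE; exact: ar.
have q_le : (q p <= r)%N by rewrite leq_div.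
(* [c_le] and [q_le] put [c j + q p] between 0 and 2r, so neither the absolute value nor the default
   of [inord] alters it. *)
pose x : {ffun 'I_m -> 'I_(r.*2.+1)} :=
  [ffun j => inord `|(c j + (q p)%:Z)%R|%N].
have xE j : x j = `|(c j + (q p)%:Z)%R|%N :> nat.
  by rewrite ffunE inordK //; move: (c_le j); lia.
apply/mapP; exists (p, x).
  rewrite mem_enum; apply/ffun_onP => j; rewrite /in_mem /= /D xE.
  by move: (c_le j); lia.
rewrite /f /= sgE; congr pair; apply/ffunP => j; rewrite ffunE cE xE.
by congr (_ * _); move: (c_le j); lia.
Qed.

(** Translating each coordinate from [0, 2r] to [-r, r] is injective and lands in the ball. *)
Lemma card_equation_ball_ge (m r : nat) :
  (r.*2.+1 ^ m.+1 <= #|` fset_set (@equation_ball m r)|)%N.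
Proof.
pose f (t : 'I_r.*2.+1 * {ffun 'I_m -> 'I_r.*2.+1}) : equation m :=
  (t.1%:Z - r%:Z, [ffun j => (t.2 j)%:Z - r%:Z]).
have f_inj : injective f.
  move=> [k x] [l y] [] /addIr[kl] xy; congr pair; first exact: val_inj.
  apply/ffunP => j; apply: val_inj; move/ffunP/(_ j): xy; rewrite !ffunE.
  by move=> /addIr[].
have -> : (r.*2.+1 ^ m.+1 = size (map f (enum predT)))%N.
  by rewrite size_map -cardE card_prod card_ffun !card_ord expnS.
apply: uniq_leq_size; first by rewrite map_inj_uniq ?enum_uniq.
move=> _ /mapP[[k x] _ ->]; rewrite in_fset_set; last exact: finite_equation_ball.
rewrite inE /equation_ball /equation_norm /= geq_max; apply/andP; split.
  by have := ltn_ord k; lia.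
by apply/bigmax_leqP => j _; rewrite ffunE /=; case: (fun_of_fin _ _) => /= n; lia.
Qed.

Lemma rho_ge0 (R : realType) (m r : nat) (S : set (equation m)) :
  0 <= rho R S r.
Proof. by rewrite divr_ge0. Qed.

(** [harmonic k] is 1/(k+1), so the series is the sum of k^-m for k from 1 to r. The count carries a
    factor r^m, the ball at least r^(m+1). *)
Lemma rho_SAT_le (R : realType) (m r : nat) (A : zmodType) (a : 'I_m -> A)
    (ha : free_basis a) : (0 < r)%N ->
  rho R (SAT a) r
    <= (1 + 2 * 3 ^+ m * series (fun k => harmonic k ^+ m) r) / r%:R.
Proof.
move=> r_gt0; have rR_gt0 : 0 < r%:R :> R by rewrite ltr0n.
have count_le : #|` fset_set (SAT a `&` @equation_ball m r)|%:R
    <= 1 + 2 * 3 ^+ m * series (fun k => harmonic k ^+ m) r * r%:R ^+ m :> R.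
  apply: (@le_trans _ _ (\sum_(k < r) ((r %/ k.+1).*2.+1 ^ m).*2).+1%:R).
    by rewrite ler_nat card_SAT_ball_le.
  rewrite -natr1 addrC lerD2l natr_sum /series /= big_mkord.
  rewrite mulr_sumr mulr_suml; apply: ler_sum => k _.
  have q_gt0 : (0 < r %/ k.+1)%N by rewrite divn_gt0.
  (* The quotient q is at least 1, so 2q + 1 <= 3q. *)
  have term_le : (r %/ k.+1).*2.+1%:R <= 3 * k.+1%:R^-1 * r%:R :> R.
    rewrite mulrAC ler_pdivlMr ?ltr0n // -natrM -natrM ler_nat.
    by have := leq_divM r k.+1; nia.
  rewrite -muln2 natrM natrX mulrC -!mulrA ler_pM2l //.
  by rewrite mulrA -!exprMn lerXn2r ?nnegrE ?mulr_ge0.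
have ball_ge : r%:R ^+ m * r%:R <= #|` fset_set (@equation_ball m r)|%:R :> R.
  rewrite -exprSr -natrX ler_nat (leq_trans _ (card_equation_ball_ge m r)) //.
  by rewrite leq_exp2r //; lia.
have ball_gt0 := lt_le_trans (mulr_gt0 (exprn_gt0 m rR_gt0) rR_gt0) ball_ge.
rewrite /rho ler_pdivrMr //; apply: (le_trans count_le).
have sum_ge0 : 0 <= series (fun k => harmonic k ^+ m) r :> R.
  by rewrite /series /= sumr_ge0.
set s := 2 * 3 ^+ m * _; have s_ge0 : 0 <= s by rewrite !mulr_ge0.
have rm_ge1 : 1 <= r%:R ^+ m :> R by rewrite exprn_ege1 // ler1n.
apply: (@le_trans _ _ ((1 + s) / r%:R * (r%:R ^+ m * r%:R))).
  rewrite [leRHS](_ : _ = (1 + s) * r%:R ^+ m); last by field; rewrite gt_eqF.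
  by rewrite mulrDl mul1r lerD2r.
by rewrite ler_wpM2l // divr_ge0 // addr_ge0.
Qed.

Lemma series_harmonic_le_ln (R : realType) (r : nat) :
  (0 < r)%N -> series harmonic r <= 1 + ln r%:R :> R.
Proof.
case: r => // r _; elim: r => [|r IHr].
  by rewrite /series /= big_nat1 invr1 ln1 addr0.
rewrite seriesSr; apply: (le_trans (lerD IHr (lexx _))).
rewrite -addrA lerD2l -lerBrDl -opprB lerNr -ln_div ?posrE ?ltr0n //.
rewrite [X in ln X](_ : _ = 1 + - r.+2%:R^-1); last first.
  by rewrite -[r.+2]addn1 natrD; field.
(* The induction step is ln(1 + x) <= x at x = -1/(r+2). *)
by apply: le_ln1Dx; rewrite ltrN2 invf_lt1 ?ltr1n.
Qed.

Lemma series_harmonicX_le2 (R : realType) (m r : nat) :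
  (1 < m)%N -> series (fun k => harmonic k ^+ m) r <= 2 :> R.
Proof.
move=> m_gt1; case: r => [|r]; first by rewrite /series /= big_geq.
(* The strengthened bound telescopes: 1/(r+2)^2 <= 1/(r+1) - 1/(r+2). *)
suff: series (fun k => harmonic k ^+ m) r.+1 <= 2 - r.+1%:R^-1 :> R.
  by move/le_trans; apply; rewrite gerBl.
elim: r => [|r IHr].
  by rewrite /series /= big_nat1 invr1 expr1n; lra.
have harmonicX_le : harmonic r.+1 ^+ m <= harmonic r.+1 ^+ 2 :> R.
  by rewrite ler_wiXn2l //= invf_le1 ?ler1n.
rewrite seriesSr; apply: (le_trans (lerD IHr harmonicX_le)).
rewrite -addrA lerD2l /= -lerBrDl.
rewrite [leRHS](_ : _ = (r.+1%:R * r.+2%:R)^-1); last first.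
  by rewrite -[r.+2]addn1 natrD; field; rewrite nat1r natr1 !pnatr_eq0.
by rewrite exprVn lef_pV2 ?posrE ?mulr_gt0 ?exprn_gt0 // expr2 ler_wpM2r ?ler_nat.
Qed.

Theorem corollary2p7 (R : realType) (m : nat) (A : zmodType) (a : 'I_m -> A)
    (hm : (1 <= m)%N) (ha : free_basis a) :
  [/\ rho R (SAT a) r @[r --> \oo] --> (0 : R),
      m = 1%N ->
        rho R (SAT a) =O_\oo (fun r : nat => ln r%:R / r%:R : R)
    & (2 <= m)%N ->
        rho R (SAT a) =O_\oo (fun r : nat => 1 / r%:R : R)].
Proof.
split.
(* At r + 1 the bound on [rho] applies for every r, and since k^-m <= 1/k it is at most a
   combination of [harmonic r] and the Cesaro mean of [harmonic]. *)
- rewrite -cvg_shiftS.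
  have harmonic_mean : (harmonic r + 2 * 3 ^+ m * arithmetic_mean harmonic r : R)
      @[r --> \oo] --> (0 : R).
    rewrite [X in _ --> X](_ : 0 = 0 + 2 * 3 ^+ m * 0); last by rewrite mulr0 addr0.
    apply: cvgD; first exact: cvg_harmonic.
    apply: cvgM; [exact: cvg_cst | apply: cesaro; exact: cvg_harmonic].
  apply: (squeeze_cvgr _ (cvg_cst 0) harmonic_mean).
  near=> r; rewrite rho_ge0 /=; apply: (le_trans (rho_SAT_le R ha (ltn0Sn r))).
  rewrite mulrDl mul1r lerD2l -mulrA ler_wpM2l // mulrC ler_wpM2l //.
  rewrite /series /= ler_sum // => k _.
  by rewrite -[leRHS]expr1 ler_wiXn2l // invf_le1 ?ler1n.
(* The numerator is at most 1 + 6 (1 + ln r) = 7 + 6 ln r, and 7 <= 14 ln r once ln r >= 1/2. *)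
- move=> m1; apply/eqO_exP; exists 20 => //; near=> r.
  have r_ge2 : (2 <= r)%N by near: r; exact: nbhs_infty_ge.
  have r_gt0 : 0 < r%:R :> R by rewrite ltr0n (leq_trans _ r_ge2).
  have ln_ge : 2^-1 <= ln r%:R :> R.
    (* This yields -ln r <= 1/r - 1, which is at most -1/2 for r >= 2. *)
    have /le_ln1Dx : -1 < r%:R^-1 - 1 :> R by rewrite ltrBrDl subrr invr_gt0.
    rewrite addrC subrK lnV ?posrE // => ln_ge.
    have : r%:R^-1 <= 2^-1 :> R by rewrite lef_pV2 ?posrE // ler_nat.
    by lra.
  rewrite !ger0_norm ?rho_ge0 ?divr_ge0 //; last by lra.
  apply: (le_trans (rho_SAT_le R ha _)); first by rewrite (leq_trans _ r_ge2).
  rewrite mulrA ler_pM2r ?invr_gt0 //.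
  have := @series_harmonic_le_ln R r; rewrite (leq_trans _ r_ge2) // => /(_ isT).
  by rewrite m1 expr1 (_ : (fun k => _ ^+ 1) = harmonic) //; lra.
- move=> m_ge2; apply/eqO_exP; exists (1 + 2 * 3 ^+ m * 2).
    by rewrite ltr_pwDl // !mulr_ge0.
  near=> r; have r_gt0 : (0 < r)%N by near: r; exact: nbhs_infty_ge.
  rewrite !ger0_norm ?rho_ge0 ?divr_ge0 // mul1r.
  apply: (le_trans (rho_SAT_le R ha r_gt0)).
  by rewrite ler_wpM2r ?invr_ge0 // lerD2l ler_wpM2l ?mulr_ge0 // series_harmonicX_le2.
Unshelve. all: by end_near. Qed.
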